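(* Let $\lambda,\nu,n$ be nonnegative integers. Let $\{P_j(y)\}_{j\ge0}$ and $\{Q_j(y)\}_{j\ge0}$ be two families of monic polynomials in $y$ with real coefficients, $P_j$ and $Q_j$ both of degree $j$. Let $f_n(k)$, $0\le k\le n$, be real numbers independent of $y$ satisfying $f_n(k)=-f_n(n-k)$ for $0\le k\le n$. Then, as $y\to\infty$ through the positive integers, \[\lim_{y\to\infty}\sum_{k=0}^n f_n(k)\,\frac{P_{\lambda k+\nu}(y)}{Q_{\lambda k+\nu}(y)}\,H_{ny+k}=0.\]
   Context: $H_0=0$ and $H_m=\sum_{j=1}^m \frac{1}{j}$ for positive integers $m$ (classical harmonic numbers). *)

(* Defs.v *)
From HB Require Import structures.
From mathcomp Require Import all_boot all_order all_algebra.
From mathcomp Require Import all_classical all_reals all_analysis.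

Set Implicit Arguments.
Unset Strict Implicit.
Unset Printing Implicit Defensive.

Import Order.TTheory GRing.Theory Num.Theory.
Import numFieldNormedType.Exports.

Local Open Scope ring_scope.

Definition harmonic_number (R : realType) (m : nat) : R :=
  \sum_(1 <= j < m.+1) j%:R^-1.

(* [size p] is the degree plus one for nonzero [p]. *)
Definition monic_of_degree (R : realType) (p : {poly R}) (j : nat) : Prop :=
  p \is monic /\ size p = j.+1.

(* Main.v *)
(** Antisymmetry of [f] gives [\sum_k f k = 0], so [H_{ny}] may be subtracted
    from every term. With [r_k = P_{lambda k + nu} / Q_{lambda k + nu}],
    [r_k H_{ny+k} - H_{ny} = r_k (H_{ny+k} - H_{ny}) + (y (r_k - 1)) (H_{ny} / y)],
    where [r_k --> 1] and [y (r_k - 1)] converges because [P] and [Q] are monic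
    of the same degree, [H_{ny+k} - H_{ny} --> 0] since it consists of [k]
    vanishing terms, and [H_{ny} / y --> 0] by Cesàro. *)
Require Import Defs.
From HB Require Import structures.
From mathcomp Require Import all_boot all_order all_algebra.
From mathcomp Require Import all_classical all_reals all_analysis.
From mathcomp Require Import ring.

Set Implicit Arguments.
Unset Strict Implicit.
Unset Printing Implicit Defensive.

Import Order.TTheory GRing.Theory Num.Theory.
Import numFieldNormedType.Exports.

Local Open Scope classical_set_scope.
Local Open Scope ring_scope.

Lemma cvg_sum_seq (R : realType) (I : Type) (s : seq I) (u : I -> nat -> R)
    (l : I -> R) :
  (forall i, u i y @[y --> \oo] --> l i) ->
  \sum_(i <- s) u i y @[y --> \oo] --> \sum_(i <- s) l i.
Proof.
move=> ul; elim: s => [|i s IHs].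
  by rewrite big_nil; under eq_fun do rewrite big_nil; exact: cvg_cst.
by rewrite big_cons; under eq_fun do rewrite big_cons; exact: cvgD.
Qed.

Lemma cvg_natV (R : realType) : (y%:R^-1 : R) @[y --> \oo] --> (0 : R).
Proof. by rewrite -cvg_shiftS; exact: cvg_harmonic. Qed.

Lemma cvg_horner_div_expn (R : realType) (p : {poly R}) (j : nat) :
  (size p <= j.+1)%N -> p.[y%:R] / y%:R ^+ j @[y --> \oo] --> p`_j.
Proof.
move=> sp.
have := @cvg_sum_seq R _ (index_enum 'I_j.+1)
  (fun i y => p`_i * (y%:R^-1) ^+ (j - i)) (fun i => p`_i * 0 ^+ (j - i)).
rewrite big_ord_recr /= subnn expr0 mulr1 big1 ?add0r; last first.
  by move=> i _; rewrite expr0n subn_eq0 leqNgt ltn_ord mulr0.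
move=> H; apply: cvg_trans (H _); last first.
  move=> i; apply: cvgMl_tmp.
  apply: (@cvg_comp _ _ _ _ (fun x : R => x ^+ (j - i))).
    exact: cvg_natV.
  exact: exprn_continuous.
apply: near_eq_cvg; near=> y.
have y0 : y%:R != 0 :> R by rewrite pnatr_eq0 -lt0n; near: y; exists 1%N.
rewrite (horner_coef_wide _ sp) mulr_suml; apply: eq_bigr => i _.
have -> : y%:R ^+ j = y%:R ^+ (j - i) * y%:R ^+ i :> R.
  by rewrite -exprD subnK // -ltnS.
by rewrite exprVn -mulf_div divff ?mulr1 ?expf_neq0.
Unshelve. all: by end_near. Qed.

Lemma cvg_horner_ratio (R : realType) (p q : {poly R}) (j : nat) :
  (size p <= j.+1)%N -> (size q <= j.+1)%N -> q`_j != 0 ->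
  p.[y%:R] / q.[y%:R] @[y --> \oo] --> p`_j / q`_j.
Proof.
move=> sp sq q0.
apply: cvg_trans (cvgM (cvg_horner_div_expn sp)
  (cvgV q0 (cvg_horner_div_expn sq))).
apply: near_eq_cvg; near=> y.
have y0 : y%:R != 0 :> R by rewrite pnatr_eq0 -lt0n; near: y; exists 1%N.
by rewrite /= invf_div mulrA divfK ?expf_neq0.
Unshelve. all: by end_near. Qed.

Lemma monic_of_degree_coef (R : realType) (p : {poly R}) (j : nat) :
  monic_of_degree p j -> p`_j = 1.
Proof. by case=> /monicP; rewrite lead_coefE => + sp; rewrite sp. Qed.

Lemma cvg_monic_ratio (R : realType) (p q : {poly R}) (j : nat) :
  monic_of_degree p j -> monic_of_degree q j ->
  p.[y%:R] / q.[y%:R] @[y --> \oo] --> (1 : R).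
Proof.
move=> hp hq; have [_ sp] := hp; have [_ sq] := hq.
have q1 := monic_of_degree_coef hq.
have := @cvg_horner_ratio _ p q j; rewrite sp sq q1 (monic_of_degree_coef hp).
by rewrite divr1; apply; rewrite ?oner_neq0.
Qed.

(** Since the leading terms cancel, [p - q] has degree below [j], so multiplying by [y] still leaves
    a numerator of degree at most [j] over [q]. *)
Lemma is_cvg_mul_monic_ratio_sub1 (R : realType) (p q : {poly R}) (j : nat) :
  monic_of_degree p j -> monic_of_degree q j ->
  cvgn (fun y => y%:R * (p.[y%:R] / q.[y%:R] - 1)).
Proof.
move=> hp hq; have [_ sp] := hp; have [_ sq] := hq.
have q1 := monic_of_degree_coef hq.
have sXd : (size ('X * (p - q))%R <= j.+1)%N.
  apply/leq_sizeP => -[//|i]; rewrite ltnS coefXM /= coefB leq_eqVlt.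
  case/predU1P => [<-|ji].
    by rewrite q1 (monic_of_degree_coef hp) subrr.
  by rewrite !nth_default ?subrr ?sp ?sq.
apply: (cvgP (('X * (p - q))`_j / q`_j)).
have := @cvg_horner_ratio _ _ q j sXd; rewrite sq q1 oner_neq0.
move=> /(_ (leqnn _) isT); apply: cvg_trans; apply: near_eq_cvg.
(* [q.[y%:R] / y%:R ^+ j] tends to 1, so [q] has no root at large [y] and [p / q - 1 = (p - q) / q]
   there. *)
have := cvg_horner_div_expn (eq_leq sq).
rewrite q1 => /cvgr_neq0 /(_ (oner_neq0 _)).
apply: filterS => y; rewrite mulf_eq0 negb_or => /andP[qy _].
by rewrite !hornerE -mulrA mulrBl divff.
Qed.

Lemma harmonic_number_series (R : realType) (m : nat) :
  harmonic_number R m = series harmonic m.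
Proof. by rewrite /harmonic_number big_add1. Qed.

Lemma harmonic_numberS (R : realType) (m : nat) :
  harmonic_number R m.+1 = harmonic_number R m + m.+1%:R^-1.
Proof. by rewrite /harmonic_number big_nat_recr. Qed.

Lemma cvg_harmonic_number_div (R : realType) :
  harmonic_number R m / m%:R @[m --> \oo] --> (0 : R).
Proof.
(* After the shift, the quotient is the arithmetic mean of [1, 1/2, ..., 1/(m+1)]. *)
rewrite -cvg_shiftS; under eq_fun do rewrite harmonic_number_series mulrC.
exact: cesaro cvg_harmonic.
Qed.

Lemma cvg_harmonic_number_shift (R : realType) (k : nat) :
  harmonic_number R (m + k)%N - harmonic_number R m @[m --> \oo] --> (0 : R).
Proof.
elim: k => [|k IHk].
  by under eq_fun do rewrite addn0 subrr; exact: cvg_cst.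
rewrite -[0]addr0.
apply: cvg_trans (cvgD IHk (cvg_comp _ _ (@cvg_addnr k) (@cvg_harmonic R))).
apply: near_eq_cvg; near=> m.
by rewrite fctE /= addnS harmonic_numberS addrAC.
Unshelve. all: by end_near. Qed.

(** Reversing the order of summation shows that twice the sum is 0. *)
Lemma sum_antisym (R : realType) (n : nat) (f : nat -> R) :
  (forall k, (k <= n)%N -> f k = - f (n - k)%N) ->
  \sum_(0 <= k < n.+1) f k = 0.
Proof.
move=> hf; set S := LHS; apply/eqP; rewrite -[_ == 0](@mulrn_eq0 _ S 2).
rewrite mulr2n {2}/S big_nat_rev /= -big_split /= big_nat big1 //.
by move=> k /andP[_ kn]; rewrite add0n subSS hf // addNr.
Qed.

Theorem theorem13 (R : realType) (lambda nu n : nat)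
    (P Q : nat -> {poly R})
    (hP : forall j : nat, monic_of_degree (P j) j)
    (hQ : forall j : nat, monic_of_degree (Q j) j)
    (f : nat -> R)
    (hf : forall k : nat, (k <= n)%N -> f k = - f (n - k)%N) :
  (\sum_(0 <= k < n.+1)
      f k * ((P (lambda * k + nu)%N).[y%:R] / (Q (lambda * k + nu)%N).[y%:R])
      * harmonic_number R (n * y + k)%N) @[y --> \oo] --> (0 : R).
Proof.
(* For [n = 0] the index [n * y] does not grow, but antisymmetry at [k = 0] forces [f 0 = 0]. *)
have [n0|n_gt0] := posnP n.
  have f0 : f 0%N = 0 by have := sum_antisym hf; rewrite n0 big_nat1.
  rewrite n0; under eq_fun do rewrite big_nat1 f0 !mul0r.
  exact: cvg_cst.
pose r k y : R :=
  (P (lambda * k + nu)%N).[y%:R] / (Q (lambda * k + nu)%N).[y%:R].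
have sumE y : \sum_(0 <= k < n.+1) f k * r k y * harmonic_number R (n * y + k)%N
    = \sum_(0 <= k < n.+1) f k *
        (r k y * harmonic_number R (n * y + k)%N - harmonic_number R (n * y)%N).
  under [RHS]eq_bigr do rewrite mulrBr mulrA.
  by rewrite sumrB -[X in _ - X]mulr_suml (sum_antisym hf) mul0r subr0.
under eq_fun do rewrite sumE.
have ny_oo := cvg_mulnl _ n_gt0.
have Hdiv : harmonic_number R (n * y)%N / y%:R @[y --> \oo] --> (0 : R).
  (* [H_{ny} / y] is [n] times [H_{ny} / (ny)], a subsequence of [H_m / m]. *)
  rewrite -[0](mulr0 n%:R).
  apply: cvg_trans (cvgMl_tmp (cvg_comp _ _ ny_oo (@cvg_harmonic_number_div R))).
  apply: near_eq_cvg; near=> y.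
  rewrite /= natrM invfM mulrCA; congr (_ * _).
  by rewrite mulrA divff ?mul1r // pnatr_eq0 -lt0n.
have := @cvg_sum_seq R nat (index_iota 0 n.+1) (fun k y => f k *
  (r k y * harmonic_number R (n * y + k)%N - harmonic_number R (n * y)%N))
  (fun=> 0).
(* With [H_{ny}] subtracted, each summand tends to 0 on its own. *)
rewrite big1 //; apply=> k; rewrite -[0](mulr0 (f k)); apply: cvgMl_tmp.
have r1 : r k y @[y --> \oo] --> (1 : R) by exact: cvg_monic_ratio.
pose yr1 y := y%:R * (r k y - 1).
have cyr1 : cvgn yr1.
  exact: is_cvg_mul_monic_ratio_sub1 (hP (lambda * k + nu)%N) (hQ _).
have Hshift :
    harmonic_number R (n * y + k)%N - harmonic_number R (n * y)%N @[y --> \oo]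
    --> (0 : R).
  exact: (cvg_comp (muln n) (fun m => harmonic_number R (m + k)%N
    - harmonic_number R m) ny_oo (@cvg_harmonic_number_shift R k)).
have rH0 : r k y * (harmonic_number R (n * y + k)%N - harmonic_number R (n * y)%N)
    + yr1 y * (harmonic_number R (n * y)%N / y%:R) @[y --> \oo] --> (0 : R).
  (* The value of [limn yr1] is irrelevant: its factor tends to 0. *)
  rewrite -[0]addr0 -{1}(mulr0 1) -[X in _ + X](mulr0 (limn yr1)).
  by apply: cvgD; [exact: cvgM r1 Hshift | exact: cvgM cyr1 Hdiv].
apply: cvg_trans rH0; apply: near_eq_cvg; near=> y.
have y0 : y%:R != 0 :> R by rewrite pnatr_eq0 -lt0n; near: y; exists 1%N.
by rewrite /yr1; field.
Unshelve. all: by end_near. Qed.
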